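(* Let $d\ge 1$, let $\mathrm{B}:\mathbb{C}^{d\times d}\to\mathbb{R}$ be $\mathrm{B}(A)=\|\mathrm{diag}(AA^*-A^*A)\|^2$, and let $\mathscr{F}:\mathbb{C}^{d\times d}\times[0,\infty)\to\mathbb{C}^{d\times d}$ be its negative gradient flow. For any $A_0\in\mathbb{C}^{d\times d}$, the limit $A_\infty=\lim_{t\to\infty}\mathscr{F}(A_0,t)$ exists, is balanced, has the same eigenvalues and principal minors as $A_0$, and has zero entries wherever $A_0$ does. If $A_0$ is real, then so is $A_\infty$, and if $A_0$ has all non-negative (real) entries, then so does $A_\infty$.
   Context: $\mathbb{C}^{d\times d}$ is regarded as a real inner product space with $\langle A,B\rangle=\mathrm{Re}\,\mathrm{tr}(B^*A)$; $\|\cdot\|$ is the Frobenius norm, $\|B\|^2=\sum_{i,j}|b_{ij}|^2$. $\mathrm{diag}:\mathbb{C}^{d\times d}\to\mathbb{C}^{d\times d}$ is the linear map that sets all off-diagonal entries to zero. A matrix $A$ is called balanced if $\mathrm{B}(A)=0$, i.e. for each $i$ the $i$th row and the $i$th column of $A$ have equal Euclidean norm. The flow $\mathscr{F}$ is defined by $\mathscr{F}(A_0,0)=A_0$ and $\frac{d}{dt}\mathscr{F}(A_0,t)=-\nabla\mathrm{B}(\mathscr{F}(A_0,t))$, with $\nabla$ the gradient with respect to $\langle\cdot,\cdot\rangle$. Eigenvalues are counted with algebraic multiplicity. ''Same principal minors'' means that for every $I\subseteq\{1,\dots,d\}$ the determinants of the submatrices with rows and columns indexed by $I$ agree. *)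

(* Defs.v *)
From HB Require Import structures.
From mathcomp Require Import all_boot all_order all_algebra.
From mathcomp Require Import all_classical all_reals all_analysis.
From mathcomp Require Import complex.
Set Implicit Arguments.
Unset Strict Implicit.
Unset Printing Implicit Defensive.
Import Order.TTheory GRing.Theory Num.Theory.
Import numFieldNormedType.Exports.
Local Open Scope classical_set_scope.
Local Open Scope ring_scope.
Local Open Scope complex_scope.

(* The library puts the norm topology of a numFieldType on the alias R[i]^o
   only; it is transported here to R[i] itself, so that 'M[R[i]]_d gets the
   library's (entrywise) topology. *)
HB.instance Definition _ (R : realType) := NormedModule.copy R[i] R[i]^o.

Section Defs.
Variables (R : realType) (d : nat).
Local Notation M := 'M[R[i]]_d.
Implicit Types (A B G H : M) (t s : R).

Definition adjmx A : M := map_mx conjc A^T.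

Definition diagmx A : M := \matrix_(i, j) (if i == j then A i j else 0).

Definition inner A B : R := complex.Re (\tr (adjmx B *m A)).

Definition frobnorm A : R :=
  Num.sqrt (\sum_i \sum_j Normc.normc (A i j) ^+ 2).

Definition imbalance A : R :=
  frobnorm (diagmx (A *m adjmx A - adjmx A *m A)) ^+ 2.

Definition balanced A : Prop := imbalance A = 0.

(* f is real Frechet differentiable at A, with derivative <_, G>. *)
Definition is_gradient (f : M -> R) A G : Prop :=
  (f (A + H) - f A - inner G H) / frobnorm H @[H --> (0 : M)^'] --> (0 : R).

(* A trajectory is defined for t >= 0; it is represented by a function on R
   whose values at negative times are irrelevant. The derivative at time t is
   the limit of difference quotients over s >= 0, s != t: two-sided when t > 0
   and one-sided when t = 0. *)
Definition is_derive_ge0 (x : R -> M) t (v : M) : Prop :=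
  ((s - t)^-1)%:C *: (x s - x t) @[s --> within `[0, +oo[ t^'] --> v.

Definition is_neg_gradient_flow (f : M -> R) (F : M -> R -> M) : Prop :=
  forall A0, F A0 0 = A0 /\
    forall t, 0 <= t ->
      exists2 G, is_gradient f (F A0 t) G & is_derive_ge0 (F A0) t (- G).

Definition alg_mult A (z : R[i]) : nat := mup z (char_poly A).

(* The order in which enum_val lists I is immaterial, since rows and columns
   are listed in the same order. *)
Definition principal_minor A (I : {set 'I_d}) : R[i] :=
  \det (mxsub (@enum_val _ (mem I)) (@enum_val _ (mem I)) A).

Definition real_mx A : Prop := forall i j, complex.Im (A i j) = 0.

(* In R[i], 0 <= z means that z is real and non-negative. *)
Definition nonneg_mx A : Prop := forall i j, 0 <= A i j.

End Defs.

(* Main.v *)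
(* Write D_i for the squared norm of row i minus that of column i. The gradient
   of B at A has entries 4 (D_i - D_j) a_ij, so the trajectory is a diagonal
   conjugation a_ij(t) = a_ij(0) exp (e_j(t) - e_i(t)) with e_i' = 4 D_i. In the
   variable e this is the gradient flow e' = -2 grad f of the convex function
   f(e) = sum_ij |a_ij(0)|^2 exp (2 (e_j - e_i)) = |A(t)|^2, and a convex
   gradient flow drives f to its infimum, attained or not: otherwise the squared
   distance from e(t) to a point z with f(z) < inf_t f(e(t)) would decrease at
   least linearly and become negative. Since
   f(e) + f(e') - 2 f((e + e') / 2) is the squared distance between the
   matrices of moduli at e and e', the trajectory A(t) is Cauchy even when e(t)
   diverges. Finally f(e)' = -8 B keeps B from having a positive limit, and
   diagonal conjugation preserves all the determinants involved. *)

Require Import Defs.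
From HB Require Import structures.
From mathcomp Require Import all_boot all_order all_algebra.
From mathcomp Require Import all_classical all_reals all_analysis.
From mathcomp Require Import complex.
From mathcomp Require Import ring lra.
Import Order.TTheory GRing.Theory Num.Theory.
Import numFieldNormedType.Exports.
Local Open Scope classical_set_scope.
Local Open Scope ring_scope.
Local Open Scope complex_scope.

Set Implicit Arguments.
Unset Strict Implicit.
Unset Printing Implicit Defensive.

(** * Convergence of complex matrices *)

Lemma normc_sqr (R : rcfType) (z : R[i]) :
  Normc.normc z ^+ 2 = complex.Re z ^+ 2 + complex.Im z ^+ 2.
Proof. by case: z => a b /=; rewrite sqr_sqrtr// addr_ge0// sqr_ge0. Qed.

Lemma norm_complexE (R : realType) (z : R[i]) : `|z| = (Normc.normc z)%:C.
Proof. by []. Qed.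

Lemma cvg_mx (R : realType) (n : nat) (T : Type) (F : set_system T)
    (FF : Filter F) (f : T -> 'M[R[i]]_n) (L : 'M[R[i]]_n) :
  (f x @[x --> F] --> L) <->
  (forall i j, f x i j @[x --> F] --> (L i j : R[i])).
Proof.
split=> [fL i j|fL].
  apply/cvg_ballP => e e0; move/cvg_ballP: fL => /(_ e e0).
  by apply: filterS => x [_ /(_ i j)].
apply/cvg_ballP => e e0.
have h : \forall x \near F, forall i j, ball (L i j) e (f x i j).
  apply: filter_forall => i; apply: filter_forall => j.
  by move/cvg_ballP: (fL i j) => /(_ e e0).
by apply: filterS h => x h; split.
Qed.

Lemma cvg_complex (R : realType) (T : Type) (F : set_system T)
    (FF : Filter F) (f : T -> R[i]) (z : R[i]) :
  (f x @[x --> F] --> z) <->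
  (complex.Re (f x) @[x --> F] --> complex.Re z /\
   complex.Im (f x) @[x --> F] --> complex.Im z).
Proof.
split=> [fz|[/cvgrPdist_lt fr /cvgrPdist_lt fi]].
  split; apply/cvgrPdist_lt => e e0.
    have e0' : 0 < e%:C by rewrite ltcR.
    move/cvgrPdist_lt: fz => /(_ _ e0'); apply: filterS => x.
    rewrite norm_complexE ltcR; apply: le_lt_trans.
    case: z (f x) => [a b] [c d] /=.
    by rewrite -sqrtr_sqr ler_wsqrtr// lerDl sqr_ge0.
  have e0' : 0 < e%:C by rewrite ltcR.
  move/cvgrPdist_lt: fz => /(_ _ e0'); apply: filterS => x.
  rewrite norm_complexE ltcR; apply: le_lt_trans.
  case: z (f x) => [a b] [c d] /=.
  by rewrite -sqrtr_sqr ler_wsqrtr// lerDr sqr_ge0.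
(* The radius ranges over [R[i]]; being positive, it is real. Half of it serves for each
   coordinate. *)
apply/cvgrPdist_lt => -[e e'].
rewrite ltcE/= => /andP[/eqP -> e0].
have e20 : 0 < e / 2 by rewrite divr_gt0.
apply: filterS2 (fr _ e20) (fi _ e20) => x {fr fi}.
case: z (f x) => [a b] [c d] /= => h1 h2.
rewrite norm_complexE complexr0 ltcR /=.
rewrite -(@ltr_pXn2r _ 2)// ?nnegrE ?sqrtr_ge0 ?ltW//.
rewrite sqr_sqrtr ?addr_ge0 ?sqr_ge0//.
rewrite -(real_normK (num_real (a - c))) -(real_normK (num_real (b - d))).
have := normr_ge0 (a - c); have := normr_ge0 (b - d); nra.
Qed.

(** * The gradient of the imbalance *)

Definition nsq (R : realType) (z : R[i]) : R :=
  complex.Re z ^+ 2 + complex.Im z ^+ 2.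

(** The inner product of the real plane, [Re (conj w * z)]. *)
Definition cdot (R : realType) (z w : R[i]) : R :=
  complex.Re z * complex.Re w + complex.Im z * complex.Im w.

(** The [i]-th diagonal entry of [A *m adjmx A - adjmx A *m A]. *)
Definition excess (R : realType) (d : nat) (A : 'M[R[i]]_d) (i : 'I_d) : R :=
  \sum_j (nsq (A i j) - nsq (A j i)).

(** The expected gradient; [gradient_unique] identifies it with whichever gradient the flow
    supplies. *)
Definition imbalance_grad (R : realType) (d : nat) (A : 'M[R[i]]_d) :
    'M[R[i]]_d :=
  \matrix_(i, j) ((4 * (excess A i - excess A j))%:C * A i j).

Lemma Re_sum (R : realType) (I : finType) (F : I -> R[i]) :
  complex.Re (\sum_i F i) = \sum_i complex.Re (F i).
Proof. by apply: (big_morph (@complex.Re R)) => // -[? ?] [? ?]. Qed.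

Lemma Re_scale (R : realType) (s : R) (z : R[i]) :
  complex.Re (s%:C * z) = s * complex.Re z.
Proof. by case: z => a b /=; ring. Qed.

Lemma Im_scale (R : realType) (s : R) (z : R[i]) :
  complex.Im (s%:C * z) = s * complex.Im z.
Proof. by case: z => a b /=; ring. Qed.

Lemma innerE (R : realType) (d : nat) (A B : 'M[R[i]]_d) :
  inner A B = \sum_i \sum_j cdot (A i j) (B i j).
Proof.
rewrite /inner /mxtrace Re_sum exchange_big; apply: eq_bigr => i _.
rewrite mxE Re_sum; apply: eq_bigr => j _; rewrite !mxE /cdot.
by case: (A j i) (B j i) => [a b] [c e] /=; ring.
Qed.

Lemma frobnorm_sqr (R : realType) (d : nat) (A : 'M[R[i]]_d) :
  frobnorm A ^+ 2 = \sum_i \sum_j nsq (A i j).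
Proof.
rewrite sqr_sqrtr; last by do 2!apply: sumr_ge0 => ? _; rewrite sqr_ge0.
by apply: eq_bigr => i _; apply: eq_bigr => j _; rewrite normc_sqr.
Qed.

Lemma sum_nsq_eq0 (R : realType) (d : nat) (A : 'M[R[i]]_d) :
  \sum_i \sum_j nsq (A i j) = 0 -> A = 0.
Proof.
have nsq_ge0 (z : R[i]) : 0 <= nsq z by rewrite addr_ge0 ?sqr_ge0.
move=> /eqP; rewrite psumr_eq0; last by move=> i _; apply: sumr_ge0.
move=> /allP h; apply/matrixP => i j; rewrite mxE.
have := h i (mem_index_enum _); rewrite psumr_eq0// => /allP /(_ j (mem_index_enum _)).
rewrite /nsq paddr_eq0 ?sqr_ge0// !sqrf_eq0.
by case: (A i j) => a b /= /andP[/eqP -> /eqP ->].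
Qed.

Lemma imbalanceE (R : realType) (d : nat) (A : 'M[R[i]]_d) :
  imbalance A = \sum_i excess A i ^+ 2.
Proof.
rewrite /imbalance frobnorm_sqr; apply: eq_bigr => i _.
rewrite (bigD1 i)//= big1 ?addr0 => [|j ji]; last first.
  by rewrite mxE eq_sym (negbTE ji) /nsq /= expr0n addr0.
have -> : diagmx (A *m adjmx A - adjmx A *m A) i i = (excess A i)%:C.
  rewrite !mxE eqxx /excess -sumrB rmorph_sum; apply: eq_bigr => j _.
  rewrite !mxE /nsq; case: (A i j) (A j i) => [a b] [c e].
  by apply/eqP; rewrite eq_complex/=; apply/andP; split; apply/eqP; ring.
by rewrite /nsq /= expr0n addr0.
Qed.

(** The right-hand side is the chain rule for the sum of the [excess A i ^+ 2]; it arises by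
    exchanging the indices in the half weighted by [excess A j]. *)
Lemma inner_imbalance_grad (R : realType) (d : nat) (A H : 'M[R[i]]_d) :
  inner (imbalance_grad A) H =
  \sum_i 2 * excess A i *
    \sum_j (2 * cdot (A i j) (H i j) - 2 * cdot (A j i) (H j i)).
Proof.
rewrite innerE.
transitivity (\sum_i \sum_j (4 * excess A i * cdot (A i j) (H i j)) -
   \sum_j \sum_i (4 * excess A i * cdot (A j i) (H j i))); last first.
  rewrite [X in _ - X]exchange_big -sumrB; apply: eq_bigr => i _.
  by rewrite -sumrB mulr_sumr; apply: eq_bigr => j _; ring.
rewrite -sumrB; apply: eq_bigr => i _; rewrite -sumrB; apply: eq_bigr => j _.
rewrite mxE /cdot; case: (A i j) (H i j) => [a b] [c e] /=; ring.
Qed.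

(** [excess] is a quadratic form, so its expansion along a line is exact at second order. *)
Lemma excess_line (R : realType) (d : nat) (A H : 'M[R[i]]_d) (s : R) i :
  excess (A + s%:C *: H) i = excess A i +
    s * (\sum_j (2 * cdot (A i j) (H i j) - 2 * cdot (A j i) (H j i)) +
    s * excess H i).
Proof.
rewrite /excess [s * \sum_j _]mulr_sumr -big_split mulr_sumr -big_split.
apply: eq_bigr => j _ /=; rewrite !mxE /nsq /cdot.
by case: (A i j) (A j i) (H i j) (H j i) => [a b] [c e] [f g] [k l] /=; ring.
Qed.

Lemma imbalance_line_derive (R : realType) (d : nat) (A H : 'M[R[i]]_d) :
  (imbalance (A + s%:C *: H) - imbalance A) / s @[s --> 0^'+] -->
  inner (imbalance_grad A) H.
Proof.
rewrite inner_imbalance_grad.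
pose L i := \sum_j (2 * cdot (A i j) (H i j) - 2 * cdot (A j i) (H j i)).
pose Q i := excess H i.
(* Dividing the exact expansion by [s] leaves a polynomial in [s] whose constant term is the
   derivative. *)
apply: (@cvg_trans _ (\sum_i (2 * excess A i * L i +
   s * (L i ^+ 2 + 2 * excess A i * Q i + s * (2 * L i * Q i + s * Q i ^+ 2))) @[s --> (0:R)^'+])).
  apply: near_eq_cvg; near=> s.
  have s0 : s != 0 by rewrite gt_eqF.
  rewrite !imbalanceE -sumrB mulr_suml; apply: eq_bigr => i _.
  by rewrite excess_line -/(L i) -/(Q i); field.
apply: cvg_big => [|i _]; first exact: add_continuous.
rewrite -[X in _ --> X]addr0; apply: cvgD; first exact: cvg_cst.
rewrite -[X in _ --> X](mul0r
  (L i ^+ 2 + 2 * excess A i * Q i + 0 * (2 * L i * Q i + 0 * Q i ^+ 2))).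
apply: cvg_at_right_filter.
apply: cvgM; first exact: cvg_id.
apply: cvgD; first exact: cvg_cst.
apply: cvgM; first exact: cvg_id.
apply: cvgD; first exact: cvg_cst.
apply: cvgM; first exact: cvg_id.
exact: cvg_cst.
Unshelve. all: by end_near. Qed.

(** The Frechet condition is restricted to the ray spanned by [H]; [H != 0] keeps that ray in the
    punctured neighbourhood and permits division by [frobnorm H]. *)
Lemma gradient_line_derive (R : realType) (d : nat) (f : 'M[R[i]]_d -> R)
    (A G H : 'M[R[i]]_d) : H != 0 -> is_gradient f A G ->
  (f (A + s%:C *: H) - f A) / s @[s --> 0^'+] --> inner G H.
Proof.
move=> H0 fG.
have nH0 : frobnorm H != 0.
  apply/eqP => h; move/eqP: H0; apply; apply: sum_nsq_eq0.
  by rewrite -frobnorm_sqr h expr0n.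
have innerZ s : inner G (s%:C *: H) = s * inner G H.
  rewrite !innerE mulr_sumr; apply: eq_bigr => i _.
  rewrite mulr_sumr; apply: eq_bigr => j _; rewrite mxE /cdot.
  by case: (G i j) (H i j) => [a b] [c e] /=; ring.
have frobZ s : 0 < s -> frobnorm (s%:C *: H) = s * frobnorm H.
  move=> s0; apply/eqP; rewrite -(@eqrXn2 _ 2)//; last 2 first.
  - exact: sqrtr_ge0.
  - by rewrite mulr_ge0 ?sqrtr_ge0 ?ltW.
  rewrite exprMn !frobnorm_sqr mulr_sumr; apply/eqP/eq_bigr => i _.
  rewrite mulr_sumr; apply: eq_bigr => j _; rewrite mxE /nsq.
  by case: (H i j) => [a b] /=; ring.
have lineH : s%:C *: H @[s --> 0^'+] --> (0 : 'M[R[i]]_d)^'.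
  move=> P; rewrite /dnbhs /within /= => P0.
  have line0 : s%:C *: H @[s --> 0^'+] --> (0 : 'M[R[i]]_d).
    apply/cvg_mx => i j; under eq_fun do rewrite mxE.
    apply/cvg_complex; rewrite mxE /=.
    split; apply: cvg_at_right_filter.
    - have -> : (fun s => complex.Re (s%:C * H i j)) =
          (fun s => s * complex.Re (H i j)) by apply/funext => s; exact: Re_scale.
      rewrite -[X in _ --> X](mul0r (complex.Re (H i j))).
      by apply: cvgM; [exact: cvg_id|exact: cvg_cst].
    - have -> : (fun s => complex.Im (s%:C * H i j)) =
          (fun s => s * complex.Im (H i j)) by apply/funext => s; exact: Im_scale.
      rewrite -[X in _ --> X](mul0r (complex.Im (H i j))).
      by apply: cvgM; [exact: cvg_id|exact: cvg_cst].
  have h : \forall s \near (0 : R)^'+, s%:C *: H != 0 -> P (s%:C *: H).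
    exact: line0 _ P0.
  rewrite -[nbhs _ P]/(\forall s \near (0 : R)^'+, P (s%:C *: H)).
  apply: filterS2 h (nbhs_right_gt (0 : R)) => s + s0; apply.
  by rewrite scaler_eq0 negb_or H0 andbT eq_complex/= eqxx andbT gt_eqF.
have lim := cvg_comp _ _ lineH fG.
(* The normalised remainder times [frobnorm H], plus [inner G H], is the difference quotient. *)
have : (f (A + s%:C *: H) - f A - inner G (s%:C *: H)) / frobnorm (s%:C *: H) *
    frobnorm H + inner G H @[s --> 0^'+] --> 0 * frobnorm H + inner G H.
  by apply: cvgD; [apply: cvgM => //; exact: cvg_cst|exact: cvg_cst].
rewrite mul0r add0r; apply: cvg_trans; apply: near_eq_cvg; near=> s.
have s0 : 0 < s by [].
rewrite innerZ frobZ//; field.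
by rewrite nH0 gt_eqF.
Unshelve. all: by end_near. Qed.

(** Both matrices compute the derivative along every ray; along their own difference this forces
    that difference to have norm zero. *)
Lemma gradient_unique (R : realType) (d : nat) (A G : 'M[R[i]]_d) :
  is_gradient (@imbalance R d) A G -> G = imbalance_grad A.
Proof.
move=> gG; apply/eqP; rewrite -subr_eq0; apply/negPn/negP => H0.
have /eqP : inner G (G - imbalance_grad A) =
    inner (imbalance_grad A) (G - imbalance_grad A).
  exact: cvg_unique (gradient_line_derive H0 gG) (@imbalance_line_derive R d A _).
rewrite -subr_eq0 => /eqP h; move/eqP: H0; apply.
apply: sum_nsq_eq0; apply: etrans h; rewrite !innerE -sumrB. apply: eq_bigr => i _.
rewrite -sumrB; apply: eq_bigr => j _; rewrite !mxE /nsq /cdot.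
by case: (G i j) (A i j) => [a b] [c e] /=; ring.
Qed.

(** * Scalar calculus on a half-line *)

Section scalar_calculus.
Variable R : realType.
Implicit Types f g u k E : R -> R.

Lemma cvg_quotient_is_derive f (t l : R) : 0 < t ->
  (f s - f t) / (s - t) @[s --> within `[0, +oo[ t^'] --> l ->
  is_derive t 1 (fun s => f (Num.max 0 s)) l.
Proof.
move=> t0 fl.
have shiftt : h + t @[h --> (0 : R)^'] --> within `[0, +oo[ t^'.
  move=> P; rewrite /within/= => P0.
  have [e /= e0 he] := P0.
  (* Capping the radius at [t] keeps [h + t] in the half-line. *)
  exists (Num.min e t) => [|h /= ]; first by rewrite /= lt_min e0.
  rewrite sub0r normrN lt_min => /andP[he1 ht] h0.
  apply: he => /=; first by rewrite opprD addrCA subrr addr0 normrN.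
    by apply: contra h0 => /eqP h0; apply/eqP/(addIr t); rewrite add0r.
  rewrite in_itv/= andbT; move: ht; rewrite ltr_norml => /andP[+ _]; lra.
have lim : h^-1 *: (((fun s => f (Num.max 0 s)) \o shift t) (h *: 1) -
    f (Num.max 0 t)) @[h --> 0^'] --> l.
  have := cvg_comp _ _ shiftt fl; apply: cvg_trans; apply: near_eq_cvg.
  exists t => //= h /=; rewrite sub0r normrN ltr_norml => /andP[ht _] h0.
  rewrite /= [h *: 1]mulr1 addrK !max_r ?ltW//; last lra.
  by rewrite [RHS]mulrC.
by split; [exact: cvgP lim|exact: cvg_lim lim].
Qed.

Lemma cvg_quotient_continuous f :
  (forall t : R, 0 <= t -> exists l : R,
    (f s - f t) / (s - t) @[s --> within `[0, +oo[ t^'] --> l) ->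
  continuous (fun s : R => f (Num.max 0 s)).
Proof.
move=> df t; pose t' : R := Num.max 0 t.
have t'0 : 0 <= t'. by rewrite /t' le_max lexx.
have [l fl] := df _ t'0.
have maxc : Num.max (0 : R) s @[s --> (t : R)] --> within `[0, +oo[ (nbhs t').
  move=> P; rewrite /within/= => P0.
  have mc : Num.max (0 : R) s @[s --> (t : R)] --> t'.
    by apply: continuous_max; [exact: cvg_cst|exact: cvg_id].
  have h : \forall s \near (t : R), Num.max 0 s \in `[0, +oo[ -> P (Num.max 0 s).
    exact: mc _ P0.
  rewrite -[nbhs _ P]/(\forall s \near (t : R), P (Num.max 0 s)).
  apply: filterS h => s; apply.
  by rewrite /= in_itv/= andbT le_max lexx.
apply: (cvg_comp _ _ maxc).
have idt : s - t' @[s --> within `[0, +oo[ t'^'] --> t' - t'.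
  apply: cvg_within_filter; apply: cvg_within_filter.
  by apply: cvgB; [exact: cvg_id|exact: cvg_cst].
have fc : f s @[s --> within `[0, +oo[ t'^'] --> f t'.
  have : (f s - f t') / (s - t') * (s - t') + f t'
      @[s --> within `[0, +oo[ t'^'] --> l * (t' - t') + f t'.
    by apply: cvgD; [exact: cvgM|exact: cvg_cst].
  rewrite subrr mulr0 add0r; apply: cvg_trans; apply: near_eq_cvg.
  exists 1 => //= s _ s0 _; rewrite divfK ?subrK// subr_eq0//.
(* The limit so far avoids [t']; the point itself is now added back. *)
move=> P P0; have [e e0 he] := fc P P0; exists e => // s es sI.
have [->|st] := eqVneq s t'; first exact: (nbhs_singleton P0).
exact: he.
Qed.

(* Differentiability is not required at the left endpoint, where the flow only
   has a one-sided derivative. *)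
Lemma le_linear f (a c : R) : continuous f ->
  (forall t : R, a < t -> exists2 l : R, is_derive t 1 f l & l <= c) ->
  forall t : R, a <= t -> f t <= f a + c * (t - a).
Proof.
move=> cf df t at_.
have df' : forall x, x \in `]a, t[%R -> is_derive x 1 f ('D_1 f x).
  move=> x; rewrite in_itv/= => /andP[ax _].
  by have [l dl _] := df _ ax; rewrite derive_val.
move: at_ df'; rewrite le_eqVlt => /predU1P[<- _|at_ df'].
  by rewrite subrr mulr0 addr0.
have [x + fE] := MVT at_ df' (continuous_subspaceT cf).
rewrite in_itv/= => /andP[ax xt].
have [l dl lc] := df _ ax.
rewrite -lerBlDl fE derive_val ler_pM2r// subr_gt0//.
Qed.

Lemma derive0_cst f (a : R) : continuous f ->
  (forall t : R, a < t -> is_derive t 1 f 0) -> forall t : R, a <= t -> f t = f a.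
Proof.
move=> cf df t at_; apply/le_anti/andP; split.
  rewrite -[leRHS]addr0 -(mul0r (t - a)); apply: le_linear => // s /df d.
  by exists 0.
rewrite -lerN2 -[leRHS]addr0 -(mul0r (t - a)).
apply: (@le_linear (fun s => - f s)) => // [s|s /df d].
  by apply: continuousN; exact: cf.
by exists (- 0); [exact: is_deriveN|rewrite oppr0].
Qed.

Lemma antiderivative f : continuous f ->
  exists E : R -> R, [/\ E 0 = 0, continuous E &
    forall t : R, 0 < t -> is_derive t 1 E (f t)].
Proof.
(* The integral starts at [-1] so that 0 is an interior point, where the fundamental theorem also
   applies and yields continuity. *)
move=> cf; pose F (x : R) : R := (\int[lebesgue_measure]_(t in `[-1, x]) (f t))%R.
have dF (t : R) : -1 < t -> is_derive t 1 F (f t).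
  move=> t1; have tt1 : t < t + 1 by rewrite ltrDl.
  have [|dFt Ft] := @continuous_FTC1_closed R f (-1) t (t + 1) tt1 _ t1 (cf t).
    apply: continuous_compact_integrable; first exact: segment_compact.
    exact: continuous_subspaceT.
  by split=> //; rewrite -derive1E.
pose E (x : R) := F (Num.max 0 x) - F 0.
exists E; split.
- by rewrite /E maxxx subrr.
- move=> t; apply: cvgB; last exact: cvg_cst.
  apply: (@continuous_comp _ _ _ (fun s : R => Num.max 0 s) F).
    by apply: continuous_max; [exact: cvg_cst|exact: cvg_id].
  apply/differentiable_continuous/derivable1_diffP.
  have [|//] := dF (Num.max 0 t).
  by rewrite (@lt_le_trans _ _ 0) ?ltrN10// le_max lexx.
- move=> t t0; have t1 : -1 < t by rewrite (lt_trans _ t0)// ltrN10.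
  have h := is_deriveB (dF t t1) (is_derive_cst (F 0) t 1).
  rewrite subr0 in h; apply: near_eq_is_derive h.
  exists t => //= s /=; rewrite ltr_norml => /andP[_ st].
  by rewrite /E max_r//; lra.
Qed.

Lemma linear_ode u g E : continuous u -> continuous E ->
  (forall t : R, 0 < t -> is_derive t 1 E (g t)) ->
  (forall t : R, 0 < t -> is_derive t 1 u (g t * u t)) -> E 0 = 0 ->
  forall t : R, 0 <= t -> u t = u 0 * expR (E t).
Proof.
move=> cu cE dE du E0 t t0.
(* The integrating factor [expR (- E s)] makes this product constant. *)
pose v s := u s * expR (- E s).
have vE : v t = v 0.
  apply: derive0_cst => // [s|s s0].
    apply: cvgM; first exact: cu.
    apply: (@continuous_comp _ _ _ (fun s => - E s) expR).
      by apply: continuousN; exact: cE.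
    exact: continuous_expR.
  have := du s s0; have := dE s s0 => dEs dus.
  have dX : is_derive s 1 (fun s => expR (- E s)) (- g s * expR (- E s)).
    have := is_deriveN dEs => dN.
    have h := @is_derive1_comp R expR (- E) s _ _ (is_derive_expR _) dN.
    apply: is_derive_eq; rewrite mulrC. by [].
  apply: (is_derive_eq (is_deriveM dus dX)).
  by rewrite /GRing.scale /=; ring.
by rewrite -(mulr1 (u t)) -(expRxMexpNx_1 (- E t)) opprK mulrA
  -/(v t) vE /v E0 oppr0 expR0 mulr1.
Qed.

End scalar_calculus.

(** * Gradient flow of a geometric program *)

Section geometric_program.
Variables (R : realType) (d : nat) (w : 'I_d -> 'I_d -> R).
Hypothesis w_ge0 : forall i j, 0 <= w i j.
Implicit Types (z a b : 'I_d -> R).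

(* If w i j = |a_ij|^2, then potential z is the squared Frobenius norm of
   diag(exp(-z)) A diag(exp z), and net_outflow z i is the squared norm of its
   row i minus that of its column i. *)
Definition potential z : R := \sum_i \sum_j w i j * expR (z j - z i) ^+ 2.

Definition net_outflow z (i : 'I_d) : R :=
  \sum_j (w i j * expR (z j - z i) ^+ 2 - w j i * expR (z i - z j) ^+ 2).

Lemma potential_ge0 z : 0 <= potential z.
Proof. by do 2!apply: sumr_ge0 => ? _; rewrite mulr_ge0 ?sqr_ge0. Qed.

(** Summation by parts. Twice the left-hand side is the derivative of [potential] at [z] in the
    direction [b], so the gradient of [potential] is [-2] times [net_outflow]. *)
Lemma net_outflow_pairing z b :
  \sum_i \sum_j w i j * expR (z j - z i) ^+ 2 * (b j - b i) =
  - \sum_i net_outflow z i * b i.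
Proof.
rewrite /net_outflow -sumrN.
under eq_bigr do under eq_bigr do rewrite mulrBr.
under eq_bigr do rewrite sumrB.
rewrite sumrB [X in X - _]exchange_big -sumrB; apply: eq_bigr => i _ /=.
by rewrite mulr_suml -sumrB -[RHS]sumrN; apply: eq_bigr => j _; ring.
Qed.

(** The tangent-line inequality holds term by term: each term reduces to [1 + 2 * y <= expR (2 * y)]
    with a nonnegative weight. *)
Lemma potential_convex z a :
  potential a - potential z <= 2 * \sum_k net_outflow a k * (z k - a k).
Proof.
rewrite -lerN2 -mulrN -net_outflow_pairing opprB mulr_sumr -sumrB.
apply: ler_sum => i _; rewrite mulr_sumr -sumrB; apply: ler_sum => j _.
have -> : z j - z i = a j - a i + (z j - a j - (z i - a i)) by ring.
set x := a j - a i; set y := _ - (z i - a i).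
rewrite expRD exprMn -[expR y ^+ 2]expRM_natl -subr_ge0.
set W := w i j * expR x ^+ 2; set p := expR (_ * y).
have W0 : 0 <= W by rewrite mulr_ge0 ?sqr_ge0.
have -> : w i j * (expR x ^+ 2 * p) - W - 2 * (W * y) = W * (p - (1 + 2 * y)).
  by rewrite /W; ring.
by rewrite mulr_ge0// subr_ge0 expR_ge1Dx.
Qed.

(** The squared exponential at the midpoint is the product of the exponentials at [a] and [b], so
    the convexity defect is a sum of weighted squares, of which one is kept. *)
Lemma potential_midpoint a b i j :
  w i j * (expR (a j - a i) - expR (b j - b i)) ^+ 2 <=
  potential a + potential b - 2 * potential (fun k => (a k + b k) / 2).
Proof.
pose T i j := w i j * (expR (a j - a i) - expR (b j - b i)) ^+ 2.
have T0 k l : 0 <= T k l by rewrite mulr_ge0 ?sqr_ge0.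
have -> : potential a + potential b - 2 * potential (fun k => (a k + b k) / 2) =
    \sum_k \sum_l T k l.
  rewrite /potential -big_split mulr_sumr -sumrB; apply: eq_bigr => k _.
  rewrite -big_split mulr_sumr -sumrB; apply: eq_bigr => l _ /=; rewrite /T.
  rewrite -[expR (_ / 2 - _) ^+ 2]expRM_natl.
  have -> : 2%:R * ((a l + b l) / 2 - (a k + b k) / 2) =
    (a l - a k) + (b l - b k) by field.
  by rewrite (expRD (a l - a k)); ring.
rewrite (bigD1 i)//= (bigD1 j)//= -addrA lerDl addr_ge0//.
  by apply: sumr_ge0.
by do 2!apply: sumr_ge0 => ? _.
Qed.

Variable e : 'I_d -> R -> R.
Hypothesis e_cont : forall i, continuous (e i).
Local Notation pos t := (fun i => e i t).
Hypothesis e_flow : forall i (t : R), 0 < t ->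
  is_derive t 1 (e i) (4 * net_outflow (pos t) i).

Lemma potential_flow_continuous : continuous (fun t => potential (pos t)).
Proof.
move=> t; apply: cvg_big => [|i _]; first exact: add_continuous.
apply: cvg_big => [|j _]; first exact: add_continuous.
apply: cvgM; first exact: cvg_cst.
have h : expR (e j s - e i s) @[s --> t] --> expR (e j t - e i t).
  apply: (@continuous_comp _ _ _ (fun s => e j s - e i s) expR).
    by apply: cvgB; exact: e_cont.
  exact: continuous_expR.
by rewrite expr2; apply: cvgM.
Qed.

Lemma potential_flow_derive (t : R) : 0 < t ->
  is_derive t 1 (fun s => potential (pos s))
    (- 8 * \sum_i net_outflow (pos t) i ^+ 2).
Proof.
move=> t0; set D := net_outflow (pos t).
pose h i j (s : R) := w i j * expR (e j s - e i s) ^+ 2.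
have dh i j : is_derive t 1 (h i j)
    (8 * (w i j * expR (e j t - e i t) ^+ 2 * (D j - D i))).
  have d1 := is_deriveB (e_flow j t0) (e_flow i t0).
  have d2 := @is_derive1_comp R expR (e j - e i) t _ _ (is_derive_expR _) d1.
  have d3 := is_deriveM (is_derive_cst (w i j) t 1) (is_deriveX 2 d2).
  apply: (is_derive_eq d3).
  by rewrite /GRing.scale /= -/D; ring.
have dh2 := is_derive_sum (fun i => is_derive_sum (fun j => dh i j)).
have -> : (fun s => potential (pos s)) = \sum_i \sum_j h i j.
  by rewrite fct_sumE; apply/funext => s; apply: eq_bigr => i _; rewrite fct_sumE.
apply: (is_derive_eq dh2).
(* Pairing with the velocity direction [D] itself turns the derivative into a negative sum of
   squares. *)
transitivity (8 * \sum_i \sum_j w i j * expR (e j t - e i t) ^+ 2 * (D j - D i)).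
  by rewrite mulr_sumr; apply: eq_bigr => i _; rewrite -mulr_sumr.
rewrite net_outflow_pairing mulrN mulNr.
by congr (- (8 * _)); apply: eq_bigr => i _; rewrite expr2.
Qed.

Lemma potential_flow_noninc (s t : R) : 0 <= s -> s <= t ->
  potential (pos t) <= potential (pos s).
Proof.
move=> s0 st; rewrite -[leRHS]addr0 -(mul0r (t - s)).
apply: (le_linear potential_flow_continuous) st => r sr.
exists (- 8 * \sum_i net_outflow (pos r) i ^+ 2).
  by apply: potential_flow_derive; exact: le_lt_trans sr.
by rewrite mulNr oppr_le0 mulr_ge0// sumr_ge0// => i _; rewrite sqr_ge0.
Qed.

(* The squared distance from the flow to z decreases at rate at least
   4 (potential (pos t) - potential z), by convexity. *)
Lemma potential_flow_min z (c : R) : potential z < c ->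
  exists2 t : R, 0 <= t & potential (pos t) < c.
Proof.
move=> zc; apply: contrapT => hn.
have hc (t : R) : 0 <= t -> c <= potential (pos t).
  by move=> t0; rewrite leNgt; apply/negP => h; apply: hn; exists t.
pose h i (s : R) := (e i s - z i) ^+ 2.
pose dist (s : R) := \sum_i h i s.
have dist_cont : continuous dist.
  move=> t; apply: cvg_big => [|i _]; first exact: add_continuous.
  rewrite /h expr2.
  by apply: cvgM; apply: cvgB; [exact: e_cont|exact: cvg_cst|exact: e_cont|exact: cvg_cst].
have dist_derive (t : R) : 0 < t -> is_derive t 1 dist
    (\sum_i 8 * (net_outflow (pos t) i * (e i t - z i))).
  move=> t0.
  have dh i : is_derive t 1 (h i) (8 * (net_outflow (pos t) i * (e i t - z i))).
    have d1 := is_deriveX 2 (is_deriveB (e_flow i t0) (is_derive_cst (z i) t 1)).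
    apply: (is_derive_eq d1).
    by rewrite /GRing.scale /= -[(_ - _) t]/(e i t - z i); ring.
  have := is_derive_sum dh; rewrite fct_sumE; exact.
pose eps := c - potential z.
have eps0 : 0 < eps by rewrite subr_gt0.
(* By this time the linear bound on the squared distance has fallen to [-1]. *)
pose T := (dist 0 + 1) / (4 * eps).
have dist_ge0 t : 0 <= dist t by apply: sumr_ge0 => i _; exact: sqr_ge0.
have T0 : 0 <= T by rewrite divr_ge0// ?addr_ge0// mulr_ge0// ltW.
suff : dist T <= dist 0 + - (4 * eps) * (T - 0).
  rewrite subr0 mulNr {2}/T mulrC divfK; last by rewrite mulf_neq0// gt_eqF.
  by have := dist_ge0 T; lra.
apply: (le_linear dist_cont) T0 => t t0; eexists; first exact: dist_derive.
rewrite -mulr_sumr.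
have := potential_convex z (pos t); have := hc t (ltW t0).
have -> : \sum_k net_outflow (pos t) k * (z k - e k t) =
    - \sum_i net_outflow (pos t) i * (e i t - z i).
  by rewrite -sumrN; apply: eq_bigr => i _; ring.
by rewrite /eps; lra.
Qed.

(** Meant for [u] the real or imaginary part of an initial entry. The midpoint of two late positions
    cannot go below the infimum that [potential] approaches, so their convexity defect is small, and
    it bounds the squared change of the amplitude. *)
Lemma flow_amplitude_cvg i j (u : R) : u ^+ 2 <= w i j ->
  cvg (u * expR (e j t - e i t) @[t --> +oo%R]).
Proof.
move=> uw.
pose V := [set potential (pos t) | t in [set t : R | 0 <= t]].
have V_lb : has_lbound V by exists 0 => _ [t _ <-]; exact: potential_ge0.
have V_inf : has_inf V by split => //; exists (potential (pos 0)), 0 => /=.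
(* By [potential_flow_min], the infimum along the flow bounds [potential] everywhere, midpoints
   included. *)
have inf_le z : inf V <= potential z.
  rewrite leNgt; apply/negP => /potential_flow_min[t t0].
  by apply/negP; rewrite -leNgt; apply: ge_inf => //; exists t.
apply/cauchy_cvgP/cauchy_exP => eps eps0.
have eps2 : 0 < eps ^+ 2 / 2 by rewrite divr_gt0 ?exprn_gt0.
have [_ [T T0 <-] hT] := inf_adherent eps2 V_inf.
(* Two potentials within [eps ^+ 2 / 2] of the infimum leave a defect below [eps ^+ 2]. *)
have key s t : potential (pos s) < inf V + eps ^+ 2 / 2 ->
    potential (pos t) < inf V + eps ^+ 2 / 2 ->
    ball (u * expR (e j s - e i s)) eps (u * expR (e j t - e i t)).
  move=> hs ht; rewrite /ball/= -mulrBr -(@ltr_pXn2r _ 2)// ?nnegrE ?ltW//.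
  rewrite real_normK ?num_real// exprMn.
  apply: (@le_lt_trans _ _ (w i j * (expR (e j s - e i s) - expR (e j t - e i t)) ^+ 2)).
    by rewrite ler_wpM2r ?sqr_ge0.
  apply: (le_lt_trans (potential_midpoint (pos s) (pos t) i j)).
  by have := inf_le (fun k => (e k s + e k t) / 2); lra.
exists (u * expR (e j T - e i T)).
rewrite -[fmap _ _ _]/(\forall t \near +oo%R, ball _ eps (u * expR (e j t - e i t))).
near=> t; apply: key => //; apply: le_lt_trans hT.
exact: potential_flow_noninc.
Unshelve. all: by end_near. Qed.

(** Were the sum a positive [S], the potential would eventually decrease at rate at least [4 * S]
    and become negative. *)
Lemma flow_limit_balanced (b : 'I_d -> R) :
  (forall i, net_outflow (pos t) i @[t --> +oo%R] --> b i) ->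
  \sum_i b i ^+ 2 = 0.
Proof.
move=> Db; apply/eqP; rewrite eq_le andbC sumr_ge0 => [/=|i _]; last exact: sqr_ge0.
rewrite leNgt; apply/negP => S0; set S := \sum_i _ in S0.
have Dlim : \sum_i net_outflow (pos t) i ^+ 2 @[t --> +oo%R] --> S.
  apply: cvg_big => [|i _]; first exact: add_continuous.
  by rewrite expr2; apply: cvgM.
have [T [_ hT]] : \forall t \near +oo%R, S / 2 < \sum_i net_outflow (pos t) i ^+ 2.
  by apply: (cvgr_gt S) => //; rewrite ltr_pdivrMr// ltr_pMr// ltr1n.
pose T' := Num.max 0 T.
have T'0 : 0 <= T' by rewrite le_max lexx.
(* By this time the linear bound on the potential has fallen to [-1]. *)
pose t := T' + (potential (pos T') + 1) / (4 * S).
have T't : T' <= t.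
  by rewrite lerDl divr_ge0 ?addr_ge0 ?potential_ge0 ?mulr_ge0// ltW.
suff : potential (pos t) <= potential (pos T') + - (4 * S) * (t - T').
  rewrite {2}/t addrAC subrr add0r mulNr [X in _ - X]mulrC divfK;
    last by rewrite mulf_neq0// gt_eqF.
  by have := potential_ge0 (pos t); lra.
apply: (le_linear potential_flow_continuous) T't => r T'r.
eexists; first by apply: potential_flow_derive; exact: le_lt_trans T'r.
have : S / 2 < \sum_i net_outflow (pos r) i ^+ 2.
  by apply: hT; apply: le_lt_trans T'r; rewrite le_max lexx orbT.
lra.
Qed.

End geometric_program.

(** * Determinants *)

Lemma det_diag_conj (K : fieldType) (n : nat) (c : 'I_n -> K)
    (M N : 'M[K]_n) :
  (forall i, c i != 0) -> (forall i j, N i j = (c i)^-1 * M i j * c j) ->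
  \det N = \det M.
Proof.
move=> c0 NE.
have -> : N = diag_mx (\row_i (c i)^-1) *m M *m diag_mx (\row_i c i).
  by apply/matrixP => i j; rewrite mul_mx_diag mxE mul_diag_mx !mxE.
rewrite !det_mulmx !det_diag mulrAC -big_split big1 ?mul1r// => i _.
by rewrite /= !mxE mulVf.
Qed.

Lemma cvg_complexM (R : realType) (T : Type) (F : set_system T)
    (FF : Filter F) (f g : T -> R[i]) (a b : R[i]) :
  f x @[x --> F] --> a -> g x @[x --> F] --> b ->
  (f x * g x) @[x --> F] --> a * b.
Proof.
move=> /cvg_complex[fr fi] /cvg_complex[gr gi]; apply/cvg_complex.
have ReM (z w : R[i]) : complex.Re (z * w) =
    complex.Re z * complex.Re w - complex.Im z * complex.Im w.
  by case: z w => [? ?] [? ?].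
have ImM (z w : R[i]) : complex.Im (z * w) =
    complex.Re z * complex.Im w + complex.Im z * complex.Re w.
  by case: z w => [? ?] [? ?].
rewrite ReM ImM; split.
  by under eq_fun do rewrite ReM; apply: cvgB; apply: cvgM.
by under eq_fun do rewrite ImM; apply: cvgD; apply: cvgM.
Qed.

Lemma cvg_det (R : realType) (n : nat) (T : Type) (F : set_system T)
    (FF : Filter F) (f : T -> 'M[R[i]]_n) (L : 'M[R[i]]_n) :
  (forall i j, f x i j @[x --> F] --> (L i j : R[i])) ->
  \det (f x) @[x --> F] --> \det L.
Proof.
move=> fL; rewrite /determinant.
apply: cvg_big => [|s _]; first exact: add_continuous.
apply: cvg_complexM; first exact: cvg_cst.
apply: cvg_big => // -[a b]; apply: cvg_complexM.
  exact: cvg_fst.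
exact: cvg_snd.
Qed.

(** The difference vanishes at as many distinct natural numbers as its size. *)
Lemma poly_eq_horner (K : numDomainType) (p q : {poly K}) :
  (forall z, p.[z] = q.[z]) -> p = q.
Proof.
move=> pq; apply/eqP; rewrite -subr_eq0; apply/eqP.
apply: (@roots_geq_poly_eq0 _ _ [seq k%:R | k <- iota 0 (size (p - q))]).
- by apply/allP => z _; rewrite rootE hornerD hornerN pq subrr.
- by rewrite map_inj_uniq ?iota_uniq// => m n /eqP; rewrite eqr_nat => /eqP.
- by rewrite size_map size_iota.
Qed.

(** Evaluation at [z] is a ring morphism, so it commutes with the determinant. *)
Lemma horner_char_poly (K : comNzRingType) (n : nat) (A : 'M[K]_n) (z : K) :
  (char_poly A).[z] = \det (z%:M - A).
Proof.
rewrite /char_poly -horner_evalE -det_map_mx; congr (\det _).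
by apply/matrixP => i j; rewrite !mxE /= /horner_eval hornerD hornerN hornerMn hornerX hornerC.
Qed.

(** * The balancing flow *)

(* p stands for the real or the imaginary part. F A0 is frozen at negative times
   so that one-sided continuity at 0 becomes continuity. *)
Lemma flow_coord (R : realType) (d : nat) (F : 'M[R[i]]_d -> R -> 'M[R[i]]_d)
    (A0 : 'M[R[i]]_d) :
  is_neg_gradient_flow (@imbalance R d) F ->
  forall (p : R[i] -> R),
  (forall z w, p (z - w) = p z - p w) -> (forall (s : R) z, p (s%:C * z) = s * p z) ->
  (forall (T : Type) (G : set_system T) (f : T -> R[i]) (z : R[i]), Filter G ->
    f x @[x --> G] --> z -> p (f x) @[x --> G] --> p z) ->
  forall i j,
  let X (t : R) := F A0 (Num.max 0 t) in
  continuous (fun t => p (X t i j)) /\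
  forall t : R, 0 < t -> is_derive t 1 (fun t => p (X t i j))
    ((4 * excess (X t) j - 4 * excess (X t) i) * p (X t i j)).
Proof.
move=> /(_ A0)[_ dF] p pB pZ pcvg i j X.
have quot (t : R) : 0 <= t ->
    (p (F A0 s i j) - p (F A0 t i j)) / (s - t) @[s --> within `[0, +oo[ t^'] -->
    (4 * excess (F A0 t) j - 4 * excess (F A0 t) i) * p (F A0 t i j).
  move=> /dF[G /gradient_unique -> /cvg_mx /(_ i j) /pcvg].
  rewrite !mxE.
  have -> : - ((4 * (excess (F A0 t) i - excess (F A0 t) j))%:C * F A0 t i j) =
      (4 * excess (F A0 t) j - 4 * excess (F A0 t) i)%:C * F A0 t i j.
    by rewrite -mulNr -rmorphN; congr (_%:C * _); ring.
  rewrite pZ; apply: cvg_trans; apply: near_eq_cvg; apply: nearW => s.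
  by rewrite !mxE pZ pB mulrC.
split.
  apply: (@cvg_quotient_continuous R (fun t => p (F A0 t i j))) => t t0.
  by eexists; exact: quot.
move=> t t0; rewrite {2 3 4}/X max_r ?ltW//.
apply: (@cvg_quotient_is_derive R (fun t => p (F A0 t i j))) => //.
exact: quot (ltW t0).
Qed.

Lemma excess_scaling (R : realType) (d : nat) (A X : 'M[R[i]]_d)
    (z : 'I_d -> R) :
  (forall i j, X i j = (expR (z j - z i))%:C * A i j) ->
  forall i, excess X i = net_outflow (fun i j => nsq (A i j)) z i.
Proof.
move=> XE i; apply: eq_bigr => j _; rewrite !XE /nsq.
by case: (A i j) (A j i) => [a b] [c c'] /=; ring.
Qed.

Lemma cvg_excess (R : realType) (d : nat) (T : Type) (F : set_system T)
    (FF : Filter F) (f : T -> 'M[R[i]]_d) (L : 'M[R[i]]_d) :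
  (forall i j, f x i j @[x --> F] --> (L i j : R[i])) ->
  forall i, excess (f x) i @[x --> F] --> excess L i.
Proof.
move=> fL i; have cvg_nsq k l : nsq (f x k l) @[x --> F] --> nsq (L k l).
  have /cvg_complex[fr fi] := fL k l.
  by rewrite /nsq !expr2; apply: cvgD; apply: cvgM.
apply: cvg_big => [|j _]; first exact: add_continuous.
by apply: cvgB; exact: cvg_nsq.
Qed.

(** With the trajectory regarded as known, each entry solves a scalar linear equation, and [e i] is
    a primitive of [4 * excess (X t) i]. Substituting the solution back into [excess] closes the
    system in [e] alone. *)
Lemma flow_explicit (R : realType) (d : nat) (F : 'M[R[i]]_d -> R -> 'M[R[i]]_d)
    (A0 : 'M[R[i]]_d) :
  is_neg_gradient_flow (@imbalance R d) F ->
  exists e : 'I_d -> R -> R,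
  [/\ forall i, continuous (e i),
      forall t : R, 0 <= t -> forall i j,
        F A0 t i j = (expR (e j t - e i t))%:C * A0 i j
    & forall i (t : R), 0 < t -> is_derive t 1 (e i)
        (4 * net_outflow (fun i j => nsq (A0 i j)) (e^~ t) i)].
Proof.
move=> flow.
pose X (t : R) := F A0 (Num.max 0 t).
have ReB (z w : R[i]) : complex.Re (z - w) = complex.Re z - complex.Re w.
  by case: z w => [? ?] [? ?].
have ImB (z w : R[i]) : complex.Im (z - w) = complex.Im z - complex.Im w.
  by case: z w => [? ?] [? ?].
have Re_flow i j := flow_coord A0 flow ReB (@Re_scale R)
  (fun T G f z FG h => ((cvg_complex FG f z).1 h).1) i j.
have Im_flow i j := flow_coord A0 flow ImB (@Im_scale R)
  (fun T G f z FG h => ((cvg_complex FG f z).1 h).2) i j.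
have cD i : continuous (fun t => 4 * excess (X t) i).
  move=> t; apply: cvgM; first exact: cvg_cst.
  apply: cvg_excess => k l; apply/cvg_complex.
  by split; [exact: (Re_flow k l).1|exact: (Im_flow k l).1].
have [e he] := choice (fun i => antiderivative (cD i)).
exists e.
have X0 : X 0 = A0 by rewrite /X maxxx; have [] := flow A0.
have XE (t : R) : 0 <= t -> forall i j,
    X t i j = (expR (e j t - e i t))%:C * A0 i j.
  move=> t0 i j; have [ei0 cei dei] := he i; have [ej0 cej dej] := he j.
  have cE : continuous (fun s => e j s - e i s).
    by move=> s; apply: cvgB; [exact: cej|exact: cei].
  have dE (s : R) : 0 < s -> is_derive s 1 (fun s => e j s - e i s)
      (4 * excess (X s) j - 4 * excess (X s) i).
    by move=> s0; exact: is_deriveB (dej s s0) (dei s s0).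
  have E0 : e j 0 - e i 0 = 0 by rewrite ei0 ej0 subrr.
  have [cR dR] := Re_flow i j; have [cI dI] := Im_flow i j.
  have hR := linear_ode cR cE dE dR E0 t0; have hI := linear_ode cI cE dE dI E0 t0.
  move: hR hI; rewrite -/(X t) -/(X 0) X0.
  case: (X t i j) (A0 i j) => [a b] [c c'] /= -> ->.
  by apply/eqP; rewrite eq_complex/=; apply/andP; split; apply/eqP; ring.
split=> [i|t t0 i j|i t t0]; first by have [] := he i.
- by rewrite -XE// /X max_r.
- have [_ _ /(_ t t0)] := he i.
  by rewrite (excess_scaling (XE t (ltW t0))).
Qed.

Unset Implicit Arguments.

Theorem theorem4p3 (R : realType) (d : nat) (hd : (1 <= d)%N)
    (F : 'M[R[i]]_d -> R -> 'M[R[i]]_d)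
    (hF : is_neg_gradient_flow (@imbalance R d) F)
    (A0 : 'M[R[i]]_d) :
  exists Ainf : 'M[R[i]]_d,
    F A0 t @[t --> +oo%R] --> Ainf /\
    balanced Ainf /\
    (forall z : R[i], alg_mult Ainf z = alg_mult A0 z) /\
    (forall I : {set 'I_d}, principal_minor Ainf I = principal_minor A0 I) /\
    (forall i j : 'I_d, A0 i j = 0 -> Ainf i j = 0) /\
    (real_mx A0 -> real_mx Ainf) /\
    (nonneg_mx A0 -> nonneg_mx Ainf).
Proof.
have [e [e_cont eE e_flow]] := flow_explicit A0 hF.
pose w i j := nsq (A0 i j).
have w_ge0 i j : 0 <= w i j by rewrite addr_ge0 ?sqr_ge0.
have cvgRe i j : cvg (complex.Re (A0 i j) * expR (e j t - e i t) @[t --> +oo%R]).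
  by apply: (flow_amplitude_cvg w_ge0 e_cont e_flow); rewrite lerDl sqr_ge0.
have cvgIm i j : cvg (complex.Im (A0 i j) * expR (e j t - e i t) @[t --> +oo%R]).
  by apply: (flow_amplitude_cvg w_ge0 e_cont e_flow); rewrite lerDr sqr_ge0.
pose Ainf : 'M[R[i]]_d := \matrix_(i, j)
  (lim (complex.Re (A0 i j) * expR (e j t - e i t) @[t --> +oo%R]) +i*
   lim (complex.Im (A0 i j) * expR (e j t - e i t) @[t --> +oo%R])).
have FE : \forall t \near +oo%R, forall i j,
    F A0 t i j = (expR (e j t - e i t))%:C * A0 i j.
  by near=> t; apply: eE.
have entry_lim i j : F A0 t i j @[t --> +oo%R] --> Ainf i j.
  apply/cvg_complex; rewrite mxE /=; split.
    apply: cvg_trans (cvgRe i j); apply: near_eq_cvg.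
    by apply: filterS FE => t ->; rewrite Re_scale mulrC.
  apply: cvg_trans (cvgIm i j); apply: near_eq_cvg.
  by apply: filterS FE => t ->; rewrite Im_scale mulrC.
(* Diagonal conjugation fixes the determinant at all late times, hence in the limit. This serves
   both the characteristic polynomial and the principal minors. *)
have det_lim n (f : R -> 'M[R[i]]_n) (B L : 'M[R[i]]_n) (c : 'I_n -> R -> R) :
    (forall i j, f t i j @[t --> +oo%R] --> L i j) ->
    (\forall t \near +oo%R, forall i j,
      f t i j = (expR (c j t - c i t))%:C * B i j) -> \det L = \det B.
  move=> /cvg_det fL fB.
  have detf : \det (f t) @[t --> +oo%R] --> (\det B : R[i]).
    have : (fun _ : R => \det B : R[i]) t @[t --> +oo%R] --> (\det B : R[i]).
      exact: cvg_cst.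
    apply: cvg_trans; apply: near_eq_cvg.
    apply: filterS fB => t ft /=; apply/esym.
    apply: (@det_diag_conj _ _ (fun i => (expR (c i t))%:C)) => i.
      by rewrite eq_complex/= eqxx andbT gt_eqF ?expR_gt0.
    move=> j; rewrite ft expRD expRN rmorphM fmorphV; ring.
  exact: cvg_unique fL detf.
exists Ainf; split; first exact/cvg_mx.
split.
  rewrite /balanced imbalanceE.
  apply: (@flow_limit_balanced R d w w_ge0 e e_cont e_flow (excess Ainf)) => i.
  have : excess (F A0 t) i @[t --> +oo%R] --> excess Ainf i by exact: cvg_excess.
  apply: cvg_trans; apply: near_eq_cvg.
  by apply: filterS FE => t Ft; rewrite (excess_scaling Ft).
split.
  (* The polynomials are compared by their values at each [x], which are determinants to which
     [det_lim] applies. *)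
  move=> z; rewrite /alg_mult; congr (mup z _); apply: poly_eq_horner => x.
  rewrite !horner_char_poly.
  apply: (det_lim _ (fun t => x%:M - F A0 t) _ _ e).
    move=> i j; have BE (C : 'M[R[i]]_d) : (x%:M - C) i j = x%:M i j - C i j.
      by rewrite !mxE.
    rewrite BE; under eq_fun do rewrite BE.
    by apply: cvgB; [exact: cvg_cst|exact: entry_lim].
  (* On the diagonal the conjugation factor is 1, so the scalar matrix of [x] is unchanged. *)
  apply: filterS FE => t Ft i j; rewrite !mxE Ft; case: eqP => [->|_].
    by rewrite subrr expR0 !mul1r.
  by rewrite !mulr0n !sub0r mulrN.
split.
  move=> I; rewrite /principal_minor.
  apply: (det_lim _ (fun t => mxsub enum_val enum_val (F A0 t)) _ _ (fun i => e (enum_val i))).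
    by move=> i j; under eq_fun do rewrite mxE; rewrite mxE; exact: entry_lim.
  by apply: filterS FE => t Ft i j; rewrite !mxE Ft.
(* A vanishing real or imaginary part stays zero in the limit; the zero pattern, reality and
   nonnegativity all use this. *)
have lim0 (g : R -> R) : lim (0 * g t @[t --> +oo%R]) = 0.
  by under eq_fun do rewrite mul0r; exact: lim_cst.
split=> [i j Aij0|]; first by rewrite mxE Aij0 /= !lim0.
split=> [A0_real i j|A0_ge0 i j]; first by rewrite mxE /= A0_real lim0.
have := A0_ge0 i j; rewrite mxE !lecE/= => /andP[/eqP Im0 Re_ge0].
rewrite Im0 lim0 eqxx/=; apply: limr_ge => //; apply: nearW => t.
by rewrite mulr_ge0 ?expR_ge0.
Unshelve. all: by end_near. Qed.
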